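(* Let $\mathcal W$ be a measure matrix (the continuous part), let $x_1,\dots,x_s\in\mathbb R$ be distinct nodes, $n_i,m_i\ge1$ integers, and $\xi^{(i)}=(\xi^{(i)}_{k,j})$ real $n_i\times m_i$ matrices, and consider the bilinear form $$(f,h)_{\breve{\mathcal W}}:=(f,h;\mathcal W)+\sum_{i=1}^s\sum_{k=0}^{n_i-1}\sum_{j=0}^{m_i-1}\xi^{(i)}_{k,j}f^{(k)}(x_i)h^{(j)}(x_i).$$ Assume that the moment matrices $G=G_{\mathcal W}$ and $\breve G=((x^n,x^p)_{\breve{\mathcal W}})_{n,p}$ are both $LU$-factorizable, with monic bi-orthogonal sequences $P_\alpha$ and $\breve P_\alpha$ ($\alpha=1,2$) respectively, and $H=\mathrm{diag}(h_0,h_1,\dots)$ the diagonal factor of $G$. Then $\breve G$ is an additive perturbation of $G$, $\breve G=G+g$ with $g_{n,p}=N[x^n]\,\Xi\,M[x^p]^\top$, and the sequences $\breve P_\alpha$ are given, for every $k\geq 0$, in terms of objects of $\mathcal W$ only, by $$\breve P_{1,k}(x)=\Theta_*\left[\begin{array}{c|c}\mathbb I+\mathbb K^{[k]}\Xi& M[K^{[k]}(\cdot,x)]^\top\\ \hline N[P_{1,k}]\,\Xi&P_{1,k}(x)\end{array}\right],\qquad \breve P_{2,k}(x)=\Theta_*\left[\begin{array}{c|c}\mathbb I+\Xi\,\mathbb K^{[k]}& \Xi\,M[P_{2,k}]^\top\\ \hline N[K^{[k]}(x,\cdot)]&P_{2,k}(x)\end{array}\right].$$ Equivalently, $$\breve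 P_{1,k}(x)=P_{1,k}(x)-N[P_{1,k}]\,\Xi\,(\mathbb I+\mathbb K^{[k]}\Xi)^{-1}M[P_2^{[k]}]^\top (H^{[k]})^{-1}P_1^{[k]}(x),$$ $$\breve P_{2,k}(x)=P_{2,k}(x)-\big(P_2^{[k]}(x)\big)^\top(H^{[k]})^{-1}N[P_1^{[k]}]\,(\mathbb I+\Xi\,\mathbb K^{[k]})^{-1}\,\Xi\,M[P_{2,k}]^\top.$$
   Context: Semi-infinite matrices and vectors are indexed from $0$; $A^{[k]}$ denotes the leading $k\times k$ truncation of a matrix, and for a vector its first $k$ entries. A measure matrix of order $\mathcal N$ is a semi-infinite matrix $\mathcal W=(d\mu_{i,j})$ of (possibly signed) Borel measures on sets $\Omega_{i,j}\subseteq\mathbb R$, with $d\mu_{i,j}=0$ if $i>\mathcal N$ or $j>\mathcal N$; $(f,h;\mathcal W)=\sum_{n,r=0}^{\mathcal N}\int_{\Omega_{n,r}}f^{(n)}h^{(r)}d\mu_{n,r}$ (finite on polynomials); $(G_{\mathcal W})_{n,p}=(x^n,x^p;\mathcal W)$. A matrix $G$ is $LU$-factorizable if $\det G^{[k]}\ne0$ for all $k\ge1$; then $G=S_1^{-1}H(S_2^{-1})^\top$ with unique lower unitriangular $S_1,S_2$ and diagonal $H$, and $P_\alpha(x)=S_\alpha\chi(x)$ with $\chi(x)=(1,x,x^2,\dots)^\top$; similarly for $\breve G$. For a function $f$ define the row vectors $N[f]=(f(x_1),f'(x_1),\dots,f^{(n_1-1)}(x_1),\dots,f(x_s),\dots,f^{(n_s-1)}(x_s))$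 and $M[f]=(f(x_1),f'(x_1),\dots,f^{(m_1-1)}(x_1),\dots,f(x_s),\dots,f^{(m_s-1)}(x_s))$; applied to a column vector of functions, $N$ and $M$ act entrywise, giving one row per entry. $\Xi=\mathrm{diag}(\xi^{(1)},\dots,\xi^{(s)})$ is block diagonal, of size $\sum n_i\times\sum m_i$. The Christoffel–Darboux kernel is $K^{[k]}(x,y)=\sum_{l=0}^{k-1}P_{2,l}(x)h_l^{-1}P_{1,l}(y)$; $M[K^{[k]}(\cdot,x)]$ means $M$ acting on the first variable with second variable equal to $x$, and $N[K^{[k]}(x,\cdot)]$ means $N$ acting on the second variable. The CD matrix is $\mathbb K^{[k]}:=M[P_2^{[k]}]^\top(H^{[k]})^{-1}N[P_1^{[k]}]$, of size $\sum m_i\times\sum n_i$ (its entries are the partial derivatives of $K^{[k]}$ at pairs of nodes). $\Theta_*\left[\begin{array}{c|c}A&B\\ \hline C&D\end{array}\right]:=D-CA^{-1}B$. *)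

(* Defs.v *)
From HB Require Import structures.
From mathcomp Require Import all_boot all_order all_algebra.
From mathcomp Require Import all_classical all_reals all_analysis.

Set Implicit Arguments.
Unset Strict Implicit.
Unset Printing Implicit Defensive.

Import Order.TTheory GRing.Theory Num.Theory.
Import numFieldNormedType.Exports.

Local Open Scope classical_set_scope.
Local Open Scope ring_scope.

(* Integration against a signed measure, through its Jordan decomposition. *)
Section SignedIntegral.
Context {R : realType}.
Implicit Types (nu : {charge set (measurableTypeR R) -> \bar R}).
Implicit Types (D : set R) (f : R -> R).

Lemma hahn_pair nu : exists PN : set R * set R,
  hahn_decomposition nu PN.1 PN.2.
Proof.
by have [P [N PN]] := Hahn_decomposition nu; exists (P, N).
Qed.

Definition positive_part nu : {measure set (measurableTypeR R) -> \bar R} :=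
  jordan_pos (projT2 (cid (hahn_pair nu))).

Definition negative_part nu : {measure set (measurableTypeR R) -> \bar R} :=
  jordan_neg (projT2 (cid (hahn_pair nu))).

Definition signed_integrable nu D f : Prop :=
  (positive_part nu).-integrable D (EFin \o f) /\
  (negative_part nu).-integrable D (EFin \o f).

Definition signed_integral nu D f : R :=
  \int[positive_part nu]_(t in D) f t - \int[negative_part nu]_(t in D) f t.

End SignedIntegral.

(* A measure on a subset [mm_supp i j] of the line is represented by a charge *)
(* on the line that is only integrated over [mm_supp i j].  Charges have      *)
(* finite values: this is no restriction, since finiteness of the form on     *)
(* polynomials makes the constant 1 integrable for every entry.               *)
Record measure_matrix (R : realType) (order : nat) := MeasureMatrix {
  mm_supp : nat -> nat -> set R ;
  mm_charge : nat -> nat -> {charge set (measurableTypeR R) -> \bar R} ;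
  mm_supp_measurable : forall i j,
    measurable (mm_supp i j : set (measurableTypeR R)) ;
  mm_charge0 : forall i j, (order < i)%N || (order < j)%N ->
    forall A : set (measurableTypeR R), measurable A ->
      mm_charge i j A = 0%E ;
  mm_finite : forall (i j : nat) (p q : {poly R}),
    signed_integrable (mm_charge i j) (mm_supp i j)
      (fun t => derive1n i (horner p) t * derive1n j (horner q) t)
}.

Section Forms.
Context {R : realType}.
Implicit Types (f g : R -> R).

Definition sobolev_form order (W : measure_matrix R order) f g : R :=
  \sum_(i < order.+1) \sum_(j < order.+1)
    signed_integral (mm_charge W i j) (mm_supp W i j)
      (fun t => derive1n i f t * derive1n j g t).

Definition discrete_form s (x : 'I_s -> R) (n m : 'I_s -> nat)
    (xi : forall i, 'M[R]_(n i, m i)) f g : R :=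
  \sum_(i < s) \sum_(k < n i) \sum_(j < m i)
    xi i k j * derive1n k f (x i) * derive1n j g (x i).

Definition perturbed_form order (W : measure_matrix R order)
    s (x : 'I_s -> R) (n m : 'I_s -> nat)
    (xi : forall i, 'M[R]_(n i, m i)) f g : R :=
  sobolev_form W f g + discrete_form x xi f g.

Definition moment_matrix (form : (R -> R) -> (R -> R) -> R) : nat -> nat -> R :=
  fun n p => form (fun t => t ^+ n) (fun t => t ^+ p).

End Forms.

(* A semi-infinite matrix is a function [nat -> nat -> R].                    *)
Section SemiInfinite.
Context {R : realType}.
Implicit Types (G S : nat -> nat -> R) (h : nat -> R).

Definition truncation G k : 'M[R]_k := \matrix_(i < k, j < k) G i j.

Definition diag_truncation h k : 'M[R]_k := diag_mx (\row_(l < k) h l).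

Definition lu_factorizable G : Prop :=
  forall k, (1 <= k)%N -> \det (truncation G k) != 0.

Definition lower_unitriangular S : Prop :=
  (forall i, S i i = 1) /\ (forall i j, (i < j)%N -> S i j = 0).

(* G = S1^-1 H S2^-T.  Truncation commutes with inverting lower triangular    *)
(* matrices and with multiplying a lower triangular matrix on the left and an *)
(* upper triangular one on the right, so the identity is that of all leading  *)
(* truncations.                                                               *)
Definition lu_factorization G S1 h S2 : Prop :=
  [/\ lower_unitriangular S1,
      lower_unitriangular S2 &
      forall k, truncation G k =
        invmx (truncation S1 k) *m diag_truncation h k
          *m (invmx (truncation S2 k))^T].

(* The entries of S chi(t), for S lower triangular: row l stops at column l.  *)
Definition lower_poly S (l : nat) (t : R) : R := \sum_(j < l.+1) S l j * t ^+ j.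

Definition cd_kernel (P1 P2 : nat -> R -> R) h (k : nat) (t u : R) : R :=
  \sum_(l < k) P2 l t * (h l)^-1 * P1 l u.

End SemiInfinite.

Section Jets.
Context {R : realType} {s : nat}.
Implicit Types (x : 'I_s -> R) (n m : 'I_s -> nat).

(* N[f] is [jet x n f] and M[f] is [jet x m f].                               *)
Definition jet x n (f : R -> R) : 'rV[R]_(\sum_i n i) :=
  \mxrow_(i < s) (\row_(a < n i) derive1n a f (x i)).

Definition jet_col x n k (F : nat -> R -> R) : 'M[R]_(k, \sum_i n i) :=
  \matrix_(l < k) jet x n (F l).

(* The block (i, i) is [xi i]; [conform_mx] only transports it along the      *)
(* equality i = j between its dimensions.                                     *)
Definition block_diag n m (xi : forall i, 'M[R]_(n i, m i)) :
    'M[R]_(\sum_i n i, \sum_i m i) :=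
  \mxblock_(i < s, j < s)
    (if i == j then conform_mx (0 : 'M[R]_(n i, m j)) (xi i) else 0).

Definition cd_matrix x n m (P1 P2 : nat -> R -> R) (h : nat -> R) k :
    'M[R]_(\sum_i m i, \sum_i n i) :=
  (jet_col x m k P2)^T *m invmx (diag_truncation h k) *m jet_col x n k P1.

End Jets.

(* The last quasi-determinant, meaningful when A is invertible.               *)
Definition quasidet {R : realType} {p q r : nat} (A : 'M[R]_p)
    (B : 'M[R]_(p, q)) (C : 'M[R]_(r, p)) (D : 'M[R]_(r, q)) : 'M[R]_(r, q) :=
  D - C *m invmx A *m B.

(* Main.v *)
Require Import Defs.
From mathcomp Require Import all_boot all_order all_algebra.
From mathcomp Require Import all_classical all_reals all_analysis.

(** The statement is finite-dimensional for each fixed k.  Write G for the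
leading k x k block of the moment matrix, chi for the column of the monomials
x^j with j < k, and r for the row of the first k entries of row k of the full
moment matrix.  Orthogonality of P_{1,k} to the powers below k determines its
coefficients, so that P_{1,k} = x^k - r G^-1 chi ([lower_comb_solve]); the same
factorization gives S_2^T H^-1 S_1 = G^-1 ([lu_inverse]).  Both biorthogonal
sequences are thus read off from the inverses of the truncations of G and of
the perturbed matrix.

The perturbation of the truncation is N Xi M^T, where the rows of N and M are
the jets of the monomials at the nodes, and the Christoffel-Darboux matrix is
KK = M^T G^-1 N.  The identity
(1 + KK Xi)^-1 M^T G^-1 = M^T (G + N Xi M^T)^-1 ([resolvent_mul_inv]), a form
of the Woodbury formula, rewrites the solution of the perturbed system in terms
of the unperturbed one ([perturbed_solution]); invertibility of 1 + KK Xi comes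
with it ([unitmx_resolvent]), and passes to 1 + Xi KK because 1 + U V and
1 + V U are invertible together ([unitmx_1D_mulmxC]).

No integral is computed.  Differentiation enters only through the linearity of
jets on polynomials, by which the jets of P_{1,k} and its value at a point are
combinations of those of the monomials, with the same coefficients.  [lower_comb_perturbed] is therefore stated for the
combinations of an arbitrary sequence of row vectors.  The formula for P_{2,k}
is the one for P_{1,k} applied to the transposed moment matrices. *)

Local Open Scope ring_scope.
Set Implicit Arguments.
Unset Strict Implicit.
Unset Printing Implicit Defensive.

Import GRing.Theory.

(** * Additive perturbation of an invertible matrix *)

Section Perturbation.
Context {F : comUnitRingType}.

(** If Y inverts 1 + U V, then 1 - V Y U inverts 1 + V U; unlike the usual
determinant argument, this never compares determinants of different sizes. *)
Lemma unitmx_1D_mulmxC p q (U : 'M[F]_(p, q)) (V : 'M[F]_(q, p)) :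
  1%:M + U *m V \in unitmx -> 1%:M + V *m U \in unitmx.
Proof.
move=> UV; set Y := invmx (1%:M + U *m V).
have eqY : U *m V *m Y = 1%:M - Y.
  by rewrite -(mulmxV UV) mulmxDl mul1mx addrC addKr.
suff /mulmx1_unit[] : (1%:M + V *m U) *m (1%:M - V *m Y *m U) = 1%:M by [].
rewrite mulmxBr mulmx1 mulmxDl mul1mx.
have -> : V *m U *m (V *m Y *m U) = V *m U - V *m Y *m U.
  have -> : V *m U *m (V *m Y *m U) = V *m (U *m V *m Y) *m U.
    by rewrite !mulmxA.
  by rewrite eqY mulmxBr mulmxBl mulmx1.
by rewrite [X in _ - X]addrC subrK addrK.
Qed.

Context {k p q : nat} (A B : 'M[F]_k) (N : 'M[F]_(k, p)) (Xi : 'M[F]_(p, q))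
  (M : 'M[F]_(k, q)).
Hypotheses (A_unit : A \in unitmx) (B_unit : B \in unitmx).
Hypothesis B_def : B = A + N *m Xi *m M^T.

Let KK := M^T *m invmx A *m N.

(** Since A^-1 B = 1 + (A^-1 N Xi) M^T is invertible, so is the matrix
1 + M^T (A^-1 N Xi) with the two factors exchanged. *)
Lemma unitmx_resolvent : 1%:M + KK *m Xi \in unitmx.
Proof.
rewrite -mulmxA -[_ *m _ *m (N *m _)]mulmxA.
apply: unitmx_1D_mulmxC.
suff -> : 1%:M + invmx A *m (N *m Xi) *m M^T = invmx A *m B.
  by rewrite unitmx_mul unitmx_inv A_unit.
by rewrite B_def mulmxDr mulVmx // !mulmxA.
Qed.

(** Clearing both inverses, each side becomes M^T + M^T A^-1 N Xi M^T, which
is (1 + KK Xi) M^T on the one hand and M^T A^-1 B on the other. *)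
Lemma resolvent_mul_inv :
  invmx (1%:M + KK *m Xi) *m M^T *m invmx A = M^T *m invmx B.
Proof.
apply: (can_inj (mulKmx unitmx_resolvent)); apply: (can_inj (mulmxK B_unit)).
rewrite !mulmxA mulmxV ?unitmx_resolvent // mul1mx mulmxKV // mulmxDl mul1mx.
rewrite {1}B_def mulmxDr -mulmxA mulVmx // mulmx1 /KK.
by rewrite !mulmxA.
Qed.

(** With r the row that fixes the coefficients of the polynomial of degree k
and v the jet of x^k, the left-hand side is what the perturbed moment matrix
yields, and v - r A^-1 N is the jet of the unperturbed polynomial. *)
Lemma perturbed_solution (r : 'rV[F]_k) (v : 'rV[F]_p) :
  (r + v *m Xi *m M^T) *m invmx B =
  r *m invmx A
  + (v - r *m invmx A *m N) *m Xi *m invmx (1%:M + KK *m Xi) *m M^T *m invmx A.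
Proof.
have rA : r *m invmx A = r *m invmx A *m (A + N *m Xi *m M^T) *m invmx B.
  by rewrite -B_def mulmxK.
(* Only the leading r A^-1 is expanded: all terms then end with B^-1, and the
   factors in front of it are compared. *)
rewrite {1}rA.
rewrite -[_ *m M^T *m invmx A]mulmxA -[_ *m invmx (1%:M + _) *m _]mulmxA.
rewrite [invmx (1%:M + _) *m _]mulmxA resolvent_mul_inv.
rewrite !mulmxA -mulmxDl; congr (_ *m _).
rewrite mulmxDr mulmxKV // !mulmxBl !mulmxA.
by rewrite -addrA [X in _ = _ + X]addrC subrK.
Qed.

End Perturbation.

(** * Moment matrices and their triangular factors *)

Section Triangular.
Context {R : realType}.
Implicit Types (S G : nat -> nat -> R) (h : nat -> R).

(** Row l of S applied to the sequence v: the values and the jets of the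
biorthogonal polynomials are obtained from those of the monomials in this way,
for vectors of different sizes. *)
Definition lower_comb {V : lmodType R} S (v : nat -> V) (l : nat) : V :=
  \sum_(j < l.+1) S l j *: v j.

Definition stack {q} (v : nat -> 'rV[R]_q) k : 'M[R]_(k, q) :=
  \matrix_(l < k) v l.

Lemma unitmx_truncation S k : lower_unitriangular S -> truncation S k \in unitmx.
Proof.
move=> [S1 S0]; rewrite unitmxE det_trig; last first.
  by apply/is_trig_mxP => i j ij; rewrite mxE S0.
by rewrite big1 ?unitr1 // => i _; rewrite mxE S1.
Qed.

Lemma stack_lower_comb q S (v : nat -> 'rV[R]_q) k : lower_unitriangular S ->
  stack (lower_comb S v) k = truncation S k *m stack v k.
Proof.
move=> [_ S0]; apply/matrixP => i c; rewrite !mxE summxE.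
under eq_bigr do rewrite mxE; under [RHS]eq_bigr do rewrite !mxE.
rewrite (big_ord_widen k (fun j => S i j * v j 0 c)) // big_mkcond /=.
by apply: eq_bigr => j _; rewrite ltnS; case: leqP => // /S0 ->; rewrite mul0r.
Qed.

(** Bordering by the last row and column; the size is written k + 1 rather than
k.+1 to match the type of a block matrix. *)
Lemma truncationD1 G k : truncation G (k + 1) =
  block_mx (truncation G k) (\col_(i < k) G i k) (\row_(j < k) G k j) (G k k)%:M.
Proof.
apply/matrixP => i j; rewrite !mxE.
case: (splitP i) => i' ->; rewrite mxE; case: (splitP j) => j' ->;
  by rewrite !mxE ?ord1 ?addn0 ?mulr1n.
Qed.

Section Factorized.
Context (G S1 S2 : nat -> nat -> R) (h : nat -> R).
Hypotheses (luG : lu_factorizable G) (S_lu : lu_factorization G S1 h S2).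

Let S1_tri : lower_unitriangular S1. Proof. by case: S_lu. Qed.
Let S2_tri : lower_unitriangular S2. Proof. by case: S_lu. Qed.

Lemma lu_truncation_unit k : truncation G k \in unitmx.
Proof.
by case: k => [|k]; rewrite unitmxE ?det_mx00 ?unitr1 // unitfE luG.
Qed.

Lemma lu_diagonalize k :
  truncation S1 k *m truncation G k *m (truncation S2 k)^T = diag_truncation h k.
Proof.
case: S_lu => _ _ ->; have /mulmxV S1V := unitmx_truncation k S1_tri.
have /mulmxV S2V := unitmx_truncation k S2_tri.
by rewrite !mulmxA S1V mul1mx -mulmxA -trmx_mul S2V trmx1 mulmx1.
Qed.

Lemma lu_diag_unit k : diag_truncation h k \in unitmx.
Proof.
rewrite -lu_diagonalize !unitmx_mul unitmx_tr lu_truncation_unit.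
by rewrite !unitmx_truncation.
Qed.

Lemma lu_pivot_neq0 l : h l != 0.
Proof.
have := lu_diag_unit l.+1; rewrite unitmxE det_diag unitfE => /prodf_neq0.
by move=> /(_ ord_max isT); rewrite mxE.
Qed.

Lemma invmx_diag_truncation k (u : nat -> R) :
  invmx (diag_truncation h k) *m \col_(l < k) u l = \col_(l < k) ((h l)^-1 * u l).
Proof.
apply: (can_inj (mulKmx (lu_diag_unit k))); rewrite mulKVmx ?lu_diag_unit //.
by apply/colP => l; rewrite mul_diag_mx !mxE mulVKf ?lu_pivot_neq0.
Qed.

(** Inverting S_1 G S_2^T = H; this is how the Christoffel-Darboux kernel,
built from H^-1, becomes the kernel of the inverse moment matrix. *)
Lemma lu_inverse k :
  (truncation S2 k)^T *m invmx (diag_truncation h k) *m truncation S1 k =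
  invmx (truncation G k).
Proof.
have S1u := unitmx_truncation k S1_tri; have S2u := unitmx_truncation k S2_tri.
have Gu := lu_truncation_unit k; have Du := lu_diag_unit k.
apply: (can_inj (mulmxK Gu)); rewrite mulVmx //.
have S2tu : (truncation S2 k)^T \in unitmx by rewrite unitmx_tr.
apply: (can_inj (mulmxK S2tu)); rewrite mul1mx -!mulmxA.
by rewrite [truncation S1 k *m _]mulmxA lu_diagonalize mulVmx // mulmx1.
Qed.

(** Orthogonality to lower powers: the last row of S_1 G S_2^T = H vanishes left
of the diagonal, and S_2 is invertible, so the row (a, 1) of S_1 satisfies
a G + r = 0 on the first k columns. *)
Lemma lower_comb_solve q (v : nat -> 'rV[R]_q) k :
  lower_comb S1 v k =
  v k - (\row_(j < k) G k j) *m invmx (truncation G k) *m stack v k.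
Proof.
have Gu := lu_truncation_unit k.
set r := \row_(j < k) _; pose a := \row_(j < k) S1 k j.
have aG : a *m truncation G k = - r.
  (* The lower left block of S_1 G S_2^T = H at size k + 1 is (a G + r) S_2^T = 0. *)
  have /(congr1 dlsubmx) := lu_diagonalize (k + 1).
  have S2tu : (truncation S2 k)^T \in unitmx.
    by rewrite unitmx_tr unitmx_truncation.
  rewrite !truncationD1 tr_block_mx !mulmx_block block_mxKdl.
  rewrite S1_tri.1 mul1mx.
  have -> : (\col_(i < k) S2 i k)^T = 0.
    by apply/rowP => j; rewrite !mxE S2_tri.2.
  rewrite mulmx0 addr0.
  have -> : dlsubmx (diag_truncation h (k + 1)) = 0.
    apply/matrixP => i j; rewrite !mxE ord1 (_ : _ == _ = false) ?mulr0n //.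
    by apply/eqP => /(congr1 val) /= E; have := ltn_ord j; rewrite -E addn0 ltnn.
  rewrite -[X in _ = X](mul0mx _ (truncation S2 k)^T).
  by move=> /(can_inj (mulmxK S2tu)) /eqP; rewrite addr_eq0 => /eqP.
have -> : r *m invmx (truncation G k) = - a by rewrite -[r]opprK -aG mulNmx mulmxK.
rewrite mulNmx opprK /lower_comb big_ord_recr /= S1_tri.1 scale1r addrC.
congr (_ + _); apply/rowP => c; rewrite summxE mxE; apply: eq_bigr => j _.
by rewrite !mxE.
Qed.

End Factorized.

Lemma lu_factorizable_tr G : lu_factorizable G -> lu_factorizable (fun i j => G j i).
Proof.
move=> luG k k_ge1; rewrite -det_tr (_ : _^T = truncation G k) ?luG //.
by apply/matrixP => i j; rewrite !mxE.
Qed.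

Lemma lu_factorization_tr G S1 h S2 :
  lu_factorization G S1 h S2 -> lu_factorization (fun i j => G j i) S2 h S1.
Proof.
case=> S1_tri S2_tri facG; split=> // k.
have -> : truncation (fun i j => G j i) k = (truncation G k)^T.
  by apply/matrixP => i j; rewrite !mxE.
by rewrite facG !trmx_mul trmxK tr_diag_mx mulmxA.
Qed.

(** * Biorthogonal sequences of a perturbed moment matrix *)

Section PerturbedFactorization.
Context (G bG S1 S2 bS1 bS2 : nat -> nat -> R) (h bh : nat -> R).
Context {p q : nat} (v : nat -> 'rV[R]_p) (f : nat -> 'rV[R]_q)
  (Xi : 'M[R]_(p, q)).
Hypotheses (luG : lu_factorizable G) (lubG : lu_factorizable bG).
Hypotheses (S_lu : lu_factorization G S1 h S2)
  (bS_lu : lu_factorization bG bS1 bh bS2).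
Hypothesis bGE : forall a b, (bG a b)%:M = (G a b)%:M + v a *m Xi *m (f b)^T.

Let KK k := (stack (lower_comb S2 f) k)^T *m invmx (diag_truncation h k)
              *m stack (lower_comb S1 v) k.

Let KKE k : KK k = (stack f k)^T *m invmx (truncation G k) *m stack v k.
Proof.
have [S1_tri S2_tri _] := S_lu.
by rewrite /KK !stack_lower_comb // trmx_mul -(lu_inverse luG S_lu) !mulmxA.
Qed.

Let bG_entry a b : bG a b = G a b + (v a *m Xi *m (f b)^T) 0 0.
Proof. by have /matrixP/(_ 0 0) := bGE a b; rewrite !mxE !mulr1n. Qed.

Let truncation_bG k :
  truncation bG k = truncation G k + stack v k *m Xi *m (stack f k)^T.
Proof.
apply/matrixP => i j; rewrite mxE bG_entry [RHS]mxE [truncation G k i j]mxE.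
congr (_ + _); rewrite !mxE; apply: eq_bigr => c _; rewrite !mxE.
by congr (_ * _); apply: eq_bigr => d _; rewrite mxE.
Qed.

Lemma unitmx_1D_cd k : 1%:M + KK k *m Xi \in unitmx.
Proof.
rewrite KKE; apply: (unitmx_resolvent _ _ (truncation_bG k));
exact: lu_truncation_unit.
Qed.

(** Taking for w the jets or the values of the monomials gives the jets or the
values of the perturbed biorthogonal polynomials. *)
Lemma lower_comb_perturbed r (w : nat -> 'rV[R]_r) k :
  lower_comb bS1 w k =
  lower_comb S1 w k
  - lower_comb S1 v k *m Xi *m invmx (1%:M + KK k *m Xi)
      *m (stack (lower_comb S2 f) k)^T *m invmx (diag_truncation h k)
      *m stack (lower_comb S1 w) k.
Proof.
have [S1_tri S2_tri _] := S_lu.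
rewrite (lower_comb_solve lubG bS_lu) (lower_comb_solve luG S_lu w).
rewrite (lower_comb_solve luG S_lu v) !stack_lower_comb // KKE.
have -> : \row_(j < k) bG k j = \row_(j < k) G k j + v k *m Xi *m (stack f k)^T.
  apply/rowP => j; rewrite mxE bG_entry [RHS]mxE [X in _ = X + _]mxE.
  by congr (_ + _); rewrite !mxE; apply: eq_bigr => c _; rewrite !mxE.
rewrite (perturbed_solution _ _ (truncation_bG k)) ?lu_truncation_unit //.
by rewrite mulmxDl opprD addrA trmx_mul -(lu_inverse luG S_lu) !mulmxA.
Qed.

End PerturbedFactorization.
End Triangular.

(** * Jets of polynomials *)

Section JetAlgebra.
Context {R : realType}.

(** Passing to formal derivatives makes jets of polynomials linear with no
differentiability side condition. *)
Lemma derive1n_horner i (p : {poly R}) : derive1n i (horner p) = horner p^`(i).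
Proof. by elim: i => [|i IH] //; rewrite derive1nS IH -derivE derivnS. Qed.

Lemma lower_poly_horner (S : nat -> nat -> R) l :
  lower_poly S l = horner (\sum_(j < l.+1) S l j *: 'X^j).
Proof.
apply/funext => t; rewrite horner_sum; apply: eq_bigr => j _.
by rewrite hornerZ hornerXn.
Qed.

(** Evaluation at y, seen as a sequence of row vectors of size 1. *)
Lemma lower_poly_scalar (S : nat -> nat -> R) l y :
  (lower_poly S l y)%:M = lower_comb S (fun j => (y ^+ j)%:M : 'rV[R]_1) l.
Proof.
rewrite /lower_poly raddf_sum; apply: eq_bigr => j _.
by rewrite scale_scalar_mx.
Qed.

Context {s : nat} (x : 'I_s -> R).

Lemma jet_sum n k (c : 'I_k -> R) (p : 'I_k -> {poly R}) :
  jet x n (fun t => \sum_(l < k) c l * (p l).[t]) =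
  \sum_(l < k) c l *: jet x n (horner (p l)).
Proof.
have -> : (fun t => \sum_(l < k) c l * (p l).[t]) =
    horner (\sum_(l < k) c l *: p l).
  by apply/funext => t; rewrite horner_sum; apply: eq_bigr => l _; rewrite hornerZ.
apply/rowP => j; rewrite summxE !mxE derive1n_horner.
rewrite linear_sum horner_sum; apply: eq_bigr => l _ /=.
by rewrite !mxE derivnZ hornerZ derive1n_horner.
Qed.

Lemma jet_lower_poly n (S : nat -> nat -> R) l :
  jet x n (lower_poly S l) = lower_comb S (fun a => jet x n (fun t => t ^+ a)) l.
Proof.
have XnE a : (fun t : R => t ^+ a) = horner 'X^a.
  by apply/funext => t; rewrite hornerXn.
under [RHS]eq_bigr do rewrite XnE; rewrite -jet_sum; congr jet.
by apply/funext => t; apply: eq_bigr => j _; rewrite hornerXn.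
Qed.

Lemma jet_col_lower_poly n (S : nat -> nat -> R) k :
  jet_col x n k (lower_poly S) =
  stack (lower_comb S (fun a => jet x n (fun t => t ^+ a))) k.
Proof. by apply/matrixP => l j; rewrite [LHS]mxE [RHS]mxE jet_lower_poly. Qed.

(** Both partial kernels, K(., y) and K(y, .), are sums of this form. *)
Lemma jet_lower_poly_sum n (S : nat -> nat -> R) k (c : nat -> R) :
  (jet x n (fun t => \sum_(l < k) c l * lower_poly S l t))^T =
  (jet_col x n k (lower_poly S))^T *m \col_(l < k) c l.
Proof.
have -> : (fun t => \sum_(l < k) c l * lower_poly S l t) =
    fun t => \sum_(l < k) c l * (\sum_(j < l.+1) S l j *: 'X^j).[t].
  by apply/funext => t; apply: eq_bigr => l _; rewrite lower_poly_horner.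
rewrite jet_sum; apply/colP => j; rewrite mxE summxE [RHS]mxE.
by apply: eq_bigr => l _; rewrite -lower_poly_horner !mxE mulrC.
Qed.

(** Only the diagonal blocks of the product survive, one for each node, so the
discrete form has matrix Xi in the coordinates given by the jets. *)
Lemma jet_block_diag n m (xi : forall i, 'M[R]_(n i, m i)) f g :
  jet x n f *m block_diag xi *m (jet x m g)^T = (discrete_form x xi f g)%:M.
Proof.
rewrite /jet /block_diag mul_mxrow_mxblock tr_mxrow mul_mxrow_mxcol.
rewrite /discrete_form raddf_sum; apply: eq_bigr => i _.
rewrite (bigD1 i) //= eqxx conform_mx_id big1 ?addr0; last first.
  by move=> j /negPf ->; rewrite mulmx0.
apply/matrixP => a b; rewrite !ord1 !mxE mulr1n exchange_big; apply: eq_bigr => j _.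
rewrite !mxE mulr_suml; apply: eq_bigr => k _; rewrite !mxE.
by congr (_ * _); rewrite mulrC.
Qed.

Lemma col_lower_poly (S : nat -> nat -> R) k y :
  \col_(l < k) lower_poly S l y =
  stack (lower_comb S (fun j => (y ^+ j)%:M : 'rV[R]_1)) k.
Proof.
by apply/colP => l; rewrite mxE [RHS]mxE -lower_poly_scalar mxE mulr1n.
Qed.

End JetAlgebra.

(** * The perturbed biorthogonal polynomials *)

Theorem proposition10 (R : realType) (order : nat) (W : measure_matrix R order)
    (s : nat) (x : 'I_s -> R) (n m : 'I_s -> nat)
    (xi : forall i : 'I_s, 'M[R]_(n i, m i))
    (x_inj : injective x)
    (n_ge1 : forall i : 'I_s, (1 <= n i)%N)
    (m_ge1 : forall i : 'I_s, (1 <= m i)%N)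
    (S1 S2 bS1 bS2 : nat -> nat -> R) (h bh : nat -> R) :
  let G := moment_matrix (sobolev_form W) in
  let bG := moment_matrix (perturbed_form W x xi) in
  let P1 := lower_poly S1 in
  let P2 := lower_poly S2 in
  let bP1 := lower_poly bS1 in
  let bP2 := lower_poly bS2 in
  let N := jet x n in
  let M := jet x m in
  let Xi := block_diag xi in
  let K := cd_kernel P1 P2 h in
  let KK := cd_matrix x n m P1 P2 h in
  lu_factorizable G -> lu_factorizable bG ->
  lu_factorization G S1 h S2 -> lu_factorization bG bS1 bh bS2 ->
  (forall a b : nat,
     (bG a b)%:M = (G a b)%:M
       + N (fun t : R => t ^+ a) *m Xi *m (M (fun t : R => t ^+ b))^T
       :> 'M[R]_1)
  /\
  (forall k : nat,
     [/\ 1%:M + KK k *m Xi \in unitmx,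
         1%:M + Xi *m KK k \in unitmx &
         forall y : R,
         [/\ (bP1 k y)%:M =
               quasidet (1%:M + KK k *m Xi) (M (fun t : R => K k t y))^T
                        (N (P1 k) *m Xi)    (P1 k y)%:M,
             (bP2 k y)%:M =
               quasidet (1%:M + Xi *m KK k)       (Xi *m (M (P2 k))^T)
                        (N (fun t : R => K k y t)) (P2 k y)%:M,
             (bP1 k y)%:M =
               (P1 k y)%:M
               - N (P1 k) *m Xi *m invmx (1%:M + KK k *m Xi)
                   *m (jet_col x m k P2)^T *m invmx (diag_truncation h k)
                   *m (\col_(l < k) P1 l y) &
             (bP2 k y)%:M =
               (P2 k y)%:M
               - (\col_(l < k) P2 l y)^T *m invmx (diag_truncation h k)
                   *m jet_col x n k P1 *m invmx (1%:M + Xi *m KK k)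
                   *m Xi *m (M (P2 k))^T]]).
Proof.
move=> G bG P1 P2 bP1 bP2 N M Xi K KK luG lubG S_lu bS_lu.
have bGE a b : (bG a b)%:M = (G a b)%:M
    + N (fun t : R => t ^+ a) *m Xi *m (M (fun t : R => t ^+ b))^T :> 'M[R]_1.
  by rewrite jet_block_diag -raddfD.
split=> // k.
have KXi : 1%:M + KK k *m Xi \in unitmx.
  have := unitmx_1D_cd luG lubG S_lu bGE k.
  by rewrite -!jet_col_lower_poly.
have XiK : 1%:M + Xi *m KK k \in unitmx := unitmx_1D_mulmxC KXi.
have bP1E y : (bP1 k y)%:M =
    (P1 k y)%:M
    - N (P1 k) *m Xi *m invmx (1%:M + KK k *m Xi)
        *m (jet_col x m k P2)^T *m invmx (diag_truncation h k)
        *m (\col_(l < k) P1 l y) :> 'M[R]_1.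
  rewrite !lower_poly_scalar (lower_comb_perturbed luG lubG S_lu bS_lu bGE).
  by rewrite -!jet_col_lower_poly -jet_lower_poly -col_lower_poly.
have bP2E y : (bP2 k y)%:M =
    (P2 k y)%:M
    - (\col_(l < k) P2 l y)^T *m invmx (diag_truncation h k)
        *m jet_col x n k P1 *m invmx (1%:M + Xi *m KK k)
        *m Xi *m (M (P2 k))^T :> 'M[R]_1.
  (* Transposition exchanges the two sequences: S_1 with S_2, N with M, and Xi
     with its transpose; KK becomes its own transpose. *)
  have bGE_tr a b : (bG b a)%:M = (G b a)%:M
      + M (fun t : R => t ^+ a) *m Xi^T *m (N (fun t : R => t ^+ b))^T :> 'M[R]_1.
    by apply: trmx_inj; rewrite linearD /= !trmx_mul !trmxK !tr_scalar_mx mulmxA bGE.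
  apply: trmx_inj; rewrite linearB /= !trmx_mul !trmxK trmx_inv !tr_scalar_mx.
  rewrite !lower_poly_scalar.
  rewrite (lower_comb_perturbed (lu_factorizable_tr luG) (lu_factorizable_tr lubG)
             (lu_factorization_tr S_lu) (lu_factorization_tr bS_lu) bGE_tr).
  rewrite -!jet_col_lower_poly -jet_lower_poly -col_lower_poly.
  by rewrite linearD /= trmx1 !trmx_mul trmxK !trmx_inv tr_diag_mx !mulmxA.
split=> // y; split=> //.
- have -> : (fun t : R => K k t y) = fun t => \sum_(l < k) (h l)^-1 * P1 l y * P2 l t.
    by apply/funext => t; apply: eq_bigr => l _; rewrite -mulrA mulrC.
  rewrite (jet_lower_poly_sum x m S2 k (fun l => (h l)^-1 * P1 l y)).
  rewrite -(invmx_diag_truncation luG S_lu k (fun l => P1 l y)).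
  by rewrite bP1E /quasidet !mulmxA.
- have -> : N (fun t : R => K k y t) =
      (\col_(l < k) P2 l y)^T *m invmx (diag_truncation h k) *m jet_col x n k P1.
    have -> : (fun t : R => K k y t) = fun t => \sum_(l < k) (h l)^-1 * P2 l y * P1 l t.
      by apply/funext => t; apply: eq_bigr => l _; rewrite [P2 l y * _]mulrC.
    apply: trmx_inj; rewrite (jet_lower_poly_sum x n S1 k (fun l => (h l)^-1 * P2 l y)).
    rewrite -(invmx_diag_truncation luG S_lu k (fun l => P2 l y)).
    by rewrite !trmx_mul trmx_inv tr_diag_mx trmxK.
  by rewrite bP2E /quasidet !mulmxA.
Qed.
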